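(* Let $G=\mathbb{Z}_{n_1}\times\cdots\times\mathbb{Z}_{n_k}$ and let $A\subset\mathbb{C}^{\ast}$ be a finite subgroup. The number of graded isomorphism classes of $(1,2)$-symmetric $G$-graded twisted $\mathbb{C}$-algebras with structure constants taking values in $A$ is $$\prod_{i=1}^{k}|R_{n_i}|^{|G|-(k+1)}\prod_{1\le i<j\le k}|R_{n_in_j}|,$$ where, for a positive integer $n$, $R_n=\{\omega\in A : \omega^n=1\}$.
   Context: Let $K$ be a field and $G$ an abelian group (written multiplicatively) with identity $e$. A $G$-graded twisted $K$-algebra is a (not necessarily associative) $K$-algebra $W=\bigoplus_{g\in G}W_g$ with $W_aW_b\subset W_{ab}$, each $W_g$ a one-dimensional $K$-vector space, $w_a\cdot w_b\ne 0$ for all nonzero $w_a\in W_a$, $w_b\in W_b$, and a multiplicative identity $1\in W_e$. A graded basis is a choice of nonzero $w_g\in W_g$ for each $g\in G$; its structure constant is the function $C:G\times G\to K^{\ast}$ with $w_a\cdot w_b=C(a,b)w_{ab}$. Define $r:G\times G\times G\to K^{\ast}$ by $r(a,b,c)=C(b,c)\,C(ab,c)^{-1}\,C(a,bc)\,C(a,b)^{-1}$ (equivalently $w_a(w_bw_c)=r(a,b,c)(w_aw_b)w_c$); it does not depend on the choice of graded basis. $W$ is $(1,2)$-symmetric if $r(a,b,c)=r(b,a,c)$ for all $a,b,c\in G$. ''With structure constants taking values in $A$'' means that $W$ has a graded basis whose structure constant $C$ takes all its values in $A$. Two $G$-graded twisted $K$-algebras $W,V$ are graded-isomorphic if there is a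 unital $K$-algebra isomorphism $\varphi:W\to V$ with $\varphi(W_g)\subset V_g$ for all $g$. $\mathbb{Z}_n$ denotes the cyclic group of order $n$. *)

(* Defs.v *)
From HB Require Import structures.
From mathcomp Require Import all_boot all_order all_algebra all_fingroup.
From mathcomp Require Import finmap.

Set Implicit Arguments.
Unset Strict Implicit.
Unset Printing Implicit Defensive.

Import Order.TTheory GRing.Theory Num.Theory.
Local Open Scope ring_scope.

(* Not necessarily associative. The grading group is finite, so the carrier, a
   finite direct sum of lines, is necessarily finite-dimensional. *)
Record twisted_algebra (K : fieldType) (G : finGroupType) := TwistedAlgebra {
  tw_carrier :> vectType K;
  tw_comp : G -> {vspace tw_carrier};
  tw_mul : {bilinear tw_carrier -> tw_carrier -> tw_carrier};
  tw_one : tw_carrier;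
  tw_direct : directv (\sum_(g : G) tw_comp g);
  tw_full : (\sum_(g : G) tw_comp g)%VS = fullv;
  tw_dim1 : forall g, \dim (tw_comp g) = 1%N;
  tw_graded : forall a b u v, u \in tw_comp a -> v \in tw_comp b ->
    tw_mul u v \in tw_comp (a * b)%g;
  tw_mul_neq0 : forall a b u v, u \in tw_comp a -> v \in tw_comp b ->
    u != 0 -> v != 0 -> tw_mul u v != 0;
  tw_one_comp : tw_one \in tw_comp 1%g;
  tw_mul1l : left_id tw_one tw_mul;
  tw_mul1r : right_id tw_one tw_mul
}.

Definition graded_basis (K : fieldType) (G : finGroupType)
    (W : twisted_algebra K G) (w : G -> W) : Prop :=
  forall g, w g \in tw_comp W g /\ w g != 0.

(* For a graded basis [w] such a [C] exists, is unique and never vanishes. *)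
Definition structure_constant (K : fieldType) (G : finGroupType)
    (W : twisted_algebra K G) (w : G -> W) (C : G -> G -> K) : Prop :=
  forall a b, tw_mul W (w a) (w b) = C a b *: w (a * b)%g.

Definition assoc_ratio (K : fieldType) (G : finGroupType) (C : G -> G -> K)
    (a b c : G) : K :=
  C b c * (C (a * b)%g c)^-1 * C a (b * c)%g * (C a b)^-1.

(* [assoc_ratio C] is the same for all graded bases, and graded bases exist, so
   quantifying over all of them is harmless. *)
Definition symmetric12 (K : fieldType) (G : finGroupType)
    (W : twisted_algebra K G) : Prop :=
  forall (w : G -> W) (C : G -> G -> K),
    graded_basis w -> structure_constant w C ->
    forall a b c, assoc_ratio C a b c = assoc_ratio C b a c.

Definition structure_constants_in (K : fieldType) (G : finGroupType)
    (A : {pred K}) (W : twisted_algebra K G) : Prop :=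
  exists (w : G -> W) (C : G -> G -> K),
    [/\ graded_basis w, structure_constant w C & forall a b, C a b \in A].

Definition graded_isomorphic (K : fieldType) (G : finGroupType)
    (W V : twisted_algebra K G) : Prop :=
  exists phi : {linear W -> V},
    [/\ bijective phi,
        phi (tw_one W) = tw_one V,
        forall u v, phi (tw_mul W u v) = tw_mul V (phi u) (phi v)
      & forall g u, u \in tw_comp W g -> phi u \in tw_comp V g].

(* The [E]-classes of the members of [P] are exactly the [N] distinct classes
   of the representatives [f i]; [E] is meant to be an equivalence. *)
Definition number_of_classes (T : Type) (P : T -> Prop) (E : T -> T -> Prop)
    (N : nat) : Prop :=
  exists f : 'I_N -> T,
    [/\ forall i, P (f i),
        forall i j, E (f i) (f j) -> i = j
      & forall x, P x -> exists i, E x (f i)].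

(* ['I_m.-1.+1] is the additive group of integers mod [m] for every [m > 0],
   including [m = 1], whereas ['Z_1] would have order 2. *)
Definition cyclic_factor (m : nat) : finGroupType := 'I_m.-1.+1.

Definition Zprod (k : nat) (n : 'I_k -> nat) : finGroupType :=
  {dffun forall i : 'I_k, cyclic_factor (n i)}.

Definition roots_in (K : fieldType) (A : {fset K}) (n : nat) : {fset K} :=
  [fset x in A | x ^+ n == 1]%fset.

(* Main.v *)
Require Import Defs.
From HB Require Import structures.
From mathcomp Require Import all_boot all_order all_algebra all_fingroup.
From mathcomp Require Import finmap complex reals.
From mathcomp Require Import ring.

(** Write [G] for the product of the cyclic groups and [x_1, .., x_k] for its
    standard generators. For a structure constant [C], left multiplication by
    the basis vector [w_a] is the operator [L_a : w_c |-> C a c *: w_(a c)].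
    As [G] is abelian, (1,2)-symmetry says that these operators commute up to
    scalars: [L_a L_b = y a b *: L_b L_a] with [y a b = C a b / C b a].
    The scalars [y g x_l] do not depend on the graded basis, and the proof
    shows that they classify the algebra and computes their range.

    They are a complete invariant ([commutator_classifies]): the ratio [B] of
    two structure constants with the same invariants is again left symmetric,
    and its operators [L_(x_l)] commute with every [L_a]. Over an algebraically
    closed field, the [L_(x_l)] have a common eigenvector; it vanishes nowhere,
    because the generators act transitively on [G], and rescaling the basis by
    it makes [B (x_l) _] equal to 1. Then each [B a _] is invariant under all
    generators, hence constant, and [B] is a coboundary.

    They are constrained as follows ([commutator_factor_hom]): if [h ^+ m = 1]
    then [g |-> y g h ^+ m] is a character of [G]. Hence
    [q i l = y x_i x_l] is a root of unity of order dividing [n i * n l], and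
    [lam g l = y g x_l / \prod_i q i l ^+ g_i] one of order dividing [n l].
    Moreover [q l i = (q i l)^-1] and [q i i = 1], while [lam g _] is trivial
    when [g] is the identity or a generator.

    There are no other constraints: for each choice of such [lam] and
    [q i j], [i < j], an explicit [model_constant], with values in the group
    generated by the parameters, has these invariants. So the classes
    correspond to the pairs ([lam], [q]) with values in [A]: for each [l],
    there are [#|G| - 1 - k'] free values in [R_(n l)], with [k'] the number
    of nontrivial factors, and for each pair [i < j] of nontrivial factors one
    value in [R_(n i * n j)]. The pairs with exactly one trivial factor turn
    [k'] into [k] ([prod_pairs_trivial]). *)

Set Implicit Arguments.
Unset Strict Implicit.
Unset Printing Implicit Defensive.

Import Order.TTheory GRing.Theory Num.Theory.
Local Open Scope ring_scope.

(** * Graded bases and their structure constants *)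

Section GradedBases.
Variables (K : fieldType) (G : finGroupType).
Implicit Types (W V : twisted_algebra K G) (C : G -> G -> K).

Lemma comp_line W (w : G -> W) g u :
  graded_basis w -> u \in tw_comp W g -> exists k, u = k *: w g.
Proof.
move=> wB; have [wg wg0] := wB g.
suff <- : (<[w g]> = tw_comp W g)%VS by move=> /vlineP[k ->]; exists k.
by apply/eqP; rewrite eqEdim -memvE wg dim_vline wg0 tw_dim1.
Qed.

Lemma structure_constant_neq0 W (w : G -> W) C :
  graded_basis w -> structure_constant w C -> forall a b, C a b != 0.
Proof.
move=> wB Cw a b; have [[wa wa0] [wb wb0]] := (wB a, wB b).
have := tw_mul_neq0 wa wb wa0 wb0.
by rewrite Cw scaler_eq0 negb_or => /andP[].
Qed.

Lemma scale_basis_inj W (w : G -> W) g x y :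
  graded_basis w -> x *: w g = y *: w g -> x = y.
Proof.
move=> /(_ g)[_ wg0] /eqP.
by rewrite -subr_eq0 -scalerBl scaler_eq0 (negPf wg0) orbF subr_eq0 => /eqP.
Qed.

Lemma one_in_basis W (w : G -> W) C :
  graded_basis w -> structure_constant w C -> tw_one W = (C 1%g 1%g)^-1 *: w 1%g.
Proof.
move=> wB Cw; have [k def1] := comp_line wB (tw_one_comp W).
have kC : k * C 1%g 1%g = 1.
  apply: (@scale_basis_inj W w 1%g) => //.
  by rewrite -scalerA -{3}[1%g]mulg1 -Cw -linearZl_LR -def1 tw_mul1l scale1r.
have C0 := structure_constant_neq0 wB Cw 1%g 1%g.
by rewrite def1; congr (_ *: _); apply: (mulIf C0); rewrite kC mulVf.
Qed.

(** The basis vector of degree 1 is a multiple of the identity of the algebra,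
    so multiplying by it on either side multiplies by one fixed scalar. *)
Lemma structure_constant_1 W (w : G -> W) C :
  graded_basis w -> structure_constant w C ->
  (forall g, C 1%g g = C 1%g 1%g) /\ (forall g, C g 1%g = C 1%g 1%g).
Proof.
move=> wB Cw; have C0 := structure_constant_neq0 wB Cw 1%g 1%g.
have def1 := one_in_basis wB Cw.
split=> g; apply: (mulfI (invr_neq0 C0)); rewrite mulVf //;
  apply: (@scale_basis_inj W w g) => //; rewrite -scalerA scale1r.
  by rewrite -{2}[g]mul1g -Cw -linearZl_LR -def1 tw_mul1l.
by rewrite -{2}[g]mulg1 -Cw -linearZr_LR -def1 tw_mul1r.
Qed.

(** Two graded bases differ by a scalar [f g] in each degree, hence their
    structure constants by the coboundary of [f]. *)
Lemma change_basis W (w w' : G -> W) C C' :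
    graded_basis w -> structure_constant w C ->
    graded_basis w' -> structure_constant w' C' ->
  exists2 f : G -> K, forall g, f g != 0
    & forall a b, C' a b * f (a * b)%g = f a * f b * C a b.
Proof.
move=> wB Cw wB' Cw'.
have /fin_all_exists[f def_f] g : exists k, w' g = k *: w g.
  by apply: comp_line => //; case: (wB' g).
exists f => [g|a b].
  by have [_] := wB' g; rewrite def_f scaler_eq0 negb_or => /andP[].
apply: (@scale_basis_inj W w (a * b)%g) => //.
rewrite -scalerA -def_f -Cw' !def_f linearZl_LR linearZr_LR /= Cw.
by rewrite !scalerA.
Qed.

Lemma rescale_basis W (w : G -> W) C (f : G -> K) :
    graded_basis w -> structure_constant w C -> (forall g, f g != 0) ->
  graded_basis (fun g => f g *: w g) /\
  structure_constant (fun g => f g *: w g)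
    (fun a b => f a * f b * C a b / f (a * b)%g).
Proof.
move=> wB Cw f0; split=> [g|a b].
  by have [wg wg0] := wB g; rewrite memvZ // scaler_eq0 negb_or f0.
rewrite linearZl_LR linearZr_LR /= Cw !scalerA mulfVK //.
Qed.

(** * Graded isomorphism as equality of structure constants *)

Lemma iso_structure_constant W V (w : G -> W) C :
    graded_isomorphic W V -> graded_basis w -> structure_constant w C ->
  exists2 v : G -> V, graded_basis v & structure_constant v C.
Proof.
move=> [phi [/bij_inj phi_inj _ phiM phi_gr]] wB Cw.
exists (phi \o w) => [g|a b] /=.
  by have [wg wg0] := wB g; rewrite phi_gr // raddf_eq0.
by rewrite -phiM Cw linearZ.
Qed.

Lemma graded_expansion W (w : G -> W) u :
  graded_basis w -> exists x : {ffun G -> K}, u == \sum_g x g *: w g.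
Proof.
move=> wB; have /memv_sumP[us us_in ->] : u \in (\sum_g tw_comp W g)%VS.
  by rewrite tw_full memvf.
have /fin_all_exists[x def_u] g : exists k, us g = k *: w g.
  by apply: comp_line (us_in g isT).
by exists (finfun x); apply/eqP/eq_bigr => g _; rewrite ffunE.
Qed.

Lemma graded_free W (w : G -> W) (x y : {ffun G -> K}) :
  graded_basis w -> \sum_g x g *: w g = \sum_g y g *: w g -> x = y.
Proof.
move=> wB /eqP; have /directv_sum_unique-> := tw_direct W; first last.
- by move=> g _; rewrite memvZ //; case: (wB g).
- by move=> g _; rewrite memvZ //; case: (wB g).
move=> /forallP eq_xy; apply/ffunP=> g.
by have /eqP/scale_basis_inj-> := eq_xy g.
Qed.

Lemma mul_expansion W (w : G -> W) C (x y : G -> K) :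
    structure_constant w C ->
  tw_mul W (\sum_a x a *: w a) (\sum_b y b *: w b)
  = \sum_a \sum_b (x a * y b * C a b) *: w (a * b)%g.
Proof.
move=> Cw; rewrite linear_sumlz; apply: eq_bigr => a _.
rewrite linear_sumr; apply: eq_bigr => b _.
by rewrite linearZl_LR linearZr_LR /= Cw !scalerA.
Qed.

(** The expansion is unique, so that choosing one yields linear coordinates. *)
Definition graded_coord W (w : G -> W) (wB : graded_basis w) (u : W) :=
  xchoose (graded_expansion u wB).

Lemma graded_coordP W (w : G -> W) (wB : graded_basis w) u :
  u = \sum_g graded_coord wB u g *: w g.
Proof. exact/eqP/(xchooseP (graded_expansion u wB)). Qed.

Lemma graded_coordE W (w : G -> W) (wB : graded_basis w) (x : {ffun G -> K}) :
  graded_coord wB (\sum_g x g *: w g) = x.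
Proof. exact/(graded_free wB)/esym/graded_coordP. Qed.

Lemma graded_coord_linear W (w : G -> W) (wB : graded_basis w) a u v g :
  graded_coord wB (a *: u + v) g
  = a * graded_coord wB u g + graded_coord wB v g.
Proof.
pose x := [ffun g => a * graded_coord wB u g + graded_coord wB v g].
rewrite -[RHS](ffunE (fun g => a * graded_coord wB u g + graded_coord wB v g)).
congr fun_of_fin; apply: (graded_free wB); rewrite -graded_coordP.
rewrite {1}[u](graded_coordP wB) {1}[v](graded_coordP wB) scaler_sumr -big_split.
by apply: eq_bigr => h _; rewrite ffunE scalerDl scalerA.
Qed.

Section BasisMap.
Variables (W V : twisted_algebra K G) (w : G -> W) (v : G -> V).
Hypothesis wB : graded_basis w.

Definition basis_map (u : W) : V := \sum_g graded_coord wB u g *: v g.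

Lemma basis_map_is_linear : linear basis_map.
Proof.
move=> a u1 u2; rewrite /basis_map scaler_sumr -big_split.
by apply: eq_bigr => g _; rewrite graded_coord_linear scalerDl scalerA.
Qed.

HB.instance Definition _ :=
  GRing.isLinear.Build K W V _ basis_map basis_map_is_linear.

Lemma basis_map_sum (x : G -> K) :
  basis_map (\sum_g x g *: w g) = \sum_g x g *: v g.
Proof.
under eq_bigr do rewrite -[x _](ffunE x).
by rewrite /basis_map graded_coordE; apply: eq_bigr => g _; rewrite ffunE.
Qed.

Lemma basis_mapE g : basis_map (w g) = v g.
Proof.
have single (U : lmodType K) (z : G -> U) : \sum_h (g == h)%:R *: z h = z g.
  rewrite (bigD1 g) //= eqxx scale1r big1 ?addr0 // => h.
  by rewrite eq_sym => /negPf->; rewrite scale0r.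
by rewrite -single basis_map_sum single.
Qed.

End BasisMap.

Lemma basis_mapK W V (w : G -> W) (v : G -> V)
    (wB : graded_basis w) (vB : graded_basis v) :
  cancel (basis_map v wB) (basis_map w vB).
Proof. by move=> u; rewrite basis_map_sum -graded_coordP. Qed.

(** The identities need not be basis vectors, but a structure constant
    determines the coordinate of the identity on the vector of degree 1. *)
Lemma structure_constant_iso W V (w : G -> W) (v : G -> V) C :
    graded_basis w -> structure_constant w C ->
    graded_basis v -> structure_constant v C ->
  graded_isomorphic W V.
Proof.
move=> wB Cw vB Cv; exists (basis_map v wB); split.
- by exists (basis_map w vB); apply: basis_mapK.
- by rewrite (one_in_basis wB Cw) (one_in_basis vB Cv) linearZ /= basis_mapE.
- move=> u1 u2; rewrite [u1](graded_coordP wB) [u2](graded_coordP wB).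
  rewrite /= (mul_expansion _ _ Cw) !basis_map_sum (mul_expansion _ _ Cv).
  rewrite linear_sum; apply: eq_bigr => a _; rewrite linear_sum.
  by apply: eq_bigr => b _; rewrite linearZ /= basis_mapE.
- move=> g u /(comp_line wB)[k ->]; rewrite linearZ /= basis_mapE memvZ //.
  by case: (vB g).
Qed.

End GradedBases.

(** * The algebra with a prescribed structure constant *)

Section Model.
Variables (K : fieldType) (G : finGroupType) (C : G -> G -> K).
Hypothesis C_neq0 : forall a b, C a b != 0.
Hypothesis C1g : forall g, C 1%g g = 1.
Hypothesis Cg1 : forall g, C g 1%g = 1.

Local Notation T := {ffun G -> K^o}.

(** The convolution product of functions on [G], twisted by [C]. *)
Definition model_mul (u v : T) : T :=
  [ffun c => \sum_a C a (a^-1 * c)%g * u a * v (a^-1 * c)%g].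

Lemma model_mul_bilinear :
  bilinear_for (GRing.Scale.Law.clone _ _ *:%R _)
    (GRing.Scale.Law.clone _ _ *:%R _) model_mul.
Proof.
split=> [v a u1 u2|u a v1 v2]; apply/ffunP=> c;
  rewrite !ffunE scaler_sumr -big_split /=; apply: eq_bigr => g _;
  by rewrite !ffunE /GRing.scale /=; ring.
Qed.

HB.instance Definition _ :=
  bilinear_isBilinear.Build K T T T _ _ model_mul model_mul_bilinear.

Definition model_basis (g : G) : T := [ffun c => (c == g)%:R].

Lemma model_basis_mul a b :
  model_mul (model_basis a) (model_basis b) = C a b *: model_basis (a * b)%g.
Proof.
apply/ffunP=> c; rewrite !ffunE (bigD1 a) //= big1 ?addr0 => [|g].
  rewrite !ffunE eqxx mulr1 /GRing.scale /= -(inj_eq (mulgI a)) mulKVg.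
  by case: eqP => [->|_]; rewrite ?mulKg ?mulr0.
by move=> /negPf ga; rewrite ffunE ga mulr0 mul0r.
Qed.

Lemma model_basis_neq0 g : model_basis g != 0.
Proof.
by apply/eqP=> /ffunP/(_ g); rewrite !ffunE eqxx => /eqP; rewrite oner_eq0.
Qed.

Lemma model_expansion (u : T) : u = \sum_g u g *: model_basis g.
Proof.
apply/ffunP=> c; rewrite sum_ffunE (bigD1 c) //= big1 => [|g].
  by rewrite addr0 !ffunE eqxx /GRing.scale /= mulr1.
by rewrite eq_sym => /negPf gc; rewrite !ffunE gc /GRing.scale /= mulr0.
Qed.

Definition model_comp (g : G) : {vspace T} := <[model_basis g]>%VS.

Lemma model_direct : directv (\sum_g model_comp g).
Proof.
apply/directv_sum_independent => us us_in us0 g _.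
have /fin_all_exists[x def_us] h : exists k, us h = k *: model_basis h.
  by have /vlineP[k ->] := us_in h isT; exists k.
have xg0 : x g = 0.
  have /ffunP/(_ g) := us0; rewrite sum_ffunE (bigD1 g) //= big1 => [|h].
    by rewrite addr0 def_us !ffunE eqxx /GRing.scale /= mulr1.
  by rewrite eq_sym => /negPf gc; rewrite def_us !ffunE gc /GRing.scale /= mulr0.
by rewrite def_us xg0 scale0r.
Qed.

Lemma model_full : (\sum_g model_comp g)%VS = fullv.
Proof.
apply/vspaceP=> u; rewrite memvf [u]model_expansion memv_sumr // => g _.
by rewrite memvZ ?memv_line.
Qed.

Lemma model_dim1 g : \dim (model_comp g) = 1%N.
Proof. by rewrite dim_vline model_basis_neq0. Qed.

Lemma model_graded a b u v :
  u \in model_comp a -> v \in model_comp b ->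
  model_mul u v \in model_comp (a * b)%g.
Proof.
move=> /vlineP[x ->] /vlineP[y ->].
by rewrite linearZl_LR linearZr_LR /= model_basis_mul !memvZ ?memv_line.
Qed.

Lemma model_mul_neq0 a b u v :
    u \in model_comp a -> v \in model_comp b ->
  u != 0 -> v != 0 -> model_mul u v != 0.
Proof.
move=> /vlineP[x ->] /vlineP[y ->].
rewrite linearZl_LR linearZr_LR /= model_basis_mul !scaler_eq0 !negb_or.
by rewrite C_neq0 !model_basis_neq0 => /andP[-> _] /andP[-> _].
Qed.

Lemma model_mul1l : left_id (model_basis 1%g) model_mul.
Proof.
move=> u; rewrite {2}[u]model_expansion [in LHS](model_expansion u) linear_sumr.
apply: eq_bigr => g _.
by rewrite linearZr_LR /= model_basis_mul C1g mul1g scale1r.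
Qed.

Lemma model_mul1r : right_id (model_basis 1%g) model_mul.
Proof.
move=> u; rewrite {2}[u]model_expansion [in LHS](model_expansion u) linear_sumlz.
apply: eq_bigr => g _.
by rewrite linearZl_LR /= model_basis_mul Cg1 mulg1 scale1r.
Qed.

Definition model_algebra : twisted_algebra K G :=
  @TwistedAlgebra K G T model_comp model_mul (model_basis 1%g)
    model_direct model_full model_dim1 model_graded model_mul_neq0
    (memv_line _) model_mul1l model_mul1r.

Lemma model_graded_basis : @graded_basis K G model_algebra model_basis.
Proof. by move=> g; rewrite memv_line model_basis_neq0. Qed.

Lemma model_structure_constant :
  @structure_constant K G model_algebra model_basis C.
Proof. exact: model_basis_mul. Qed.

End Model.

(** * (1,2)-symmetry of a structure constant *)

(** (1,2)-symmetry with the factor [C (a * b) c], common to both sides over an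
    abelian group, cancelled and the denominators cleared. This form is stable
    under pointwise products and inverses. *)
Definition left_symmetric (K : fieldType) (G : finGroupType) (C : G -> G -> K) :=
  forall a b c : G,
    C b c * C a (b * c)%g * C b a = C a c * C b (a * c)%g * C a b.

Section LeftSymmetry.
Variables (K : fieldType) (G : finGroupType).
Hypothesis mulgC : commutative (@mulg G).
Implicit Types (W : twisted_algebra K G) (C : G -> G -> K).

Lemma assoc_ratio_left_symmetric C :
    (forall a b, C a b != 0) ->
  (forall a b c, assoc_ratio C a b c = assoc_ratio C b a c) <->
  left_symmetric C.
Proof.
move=> C0; rewrite /assoc_ratio; split=> H a b c; last first.
  have Hab := H a b c; rewrite [(b * a)%g]mulgC.
  apply: (mulIf (C0 a b)); rewrite mulfVK //; apply: (mulIf (C0 b a)).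
  rewrite [RHS]mulrAC mulfVK //; apply: (mulIf (C0 (a * b)%g c)).
  transitivity (C b c * C a (b * c)%g * C b a); first by field.
  by rewrite Hab; field.
have:= H a b c; rewrite [(b * a)%g]mulgC => Hab.
transitivity (C b c * (C (a * b)%g c)^-1 * C a (b * c)%g * (C a b)^-1
              * (C (a * b)%g c * C a b * C b a)).
  by field; rewrite !C0.
by rewrite Hab; field; rewrite !C0.
Qed.

Lemma left_symmetricM C D :
  left_symmetric C -> left_symmetric D -> left_symmetric (fun a b => C a b * D a b).
Proof.
move=> sC sD a b c; have := congr2 *%R (sC a b c) (sD a b c).
by rewrite !(mulrACA _ (C _ _)) => ->.
Qed.

Lemma left_symmetricV C :
  left_symmetric C -> left_symmetric (fun a b => (C a b)^-1).
Proof. by move=> sC a b c; rewrite -!invfM; rewrite sC. Qed.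

Lemma left_symmetric_coboundary (f : G -> K) :
  (forall g, f g != 0) -> left_symmetric (fun a b => f a * f b / f (a * b)%g).
Proof.
move=> f0 a b c; rewrite [(b * a)%g]mulgC [(b * (a * c))%g]mulgA [(b * a)%g]mulgC.
by rewrite mulgA; field; rewrite !f0.
Qed.

(** Symmetry for one basis is symmetry for all, since coboundaries are left
    symmetric. *)
Lemma symmetric12P W (w : G -> W) C :
  graded_basis w -> structure_constant w C -> symmetric12 W <-> left_symmetric C.
Proof.
move=> wB Cw; split=> [/(_ _ _ wB Cw)|sC w' C' wB' Cw'].
  by move/(assoc_ratio_left_symmetric (structure_constant_neq0 wB Cw)).
apply/(assoc_ratio_left_symmetric (structure_constant_neq0 wB' Cw')).
have [f f0 def_C'] := change_basis wB Cw wB' Cw'.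
have:= left_symmetricM (left_symmetric_coboundary f0) sC.
move=> + a b c => /(_ a b c).
have E a' b' : f a' * f b' / f (a' * b')%g * C a' b' = C' a' b'.
  by apply: (mulIf (f0 (a' * b')%g)); rewrite def_C'; field; rewrite f0.
by rewrite !E.
Qed.

End LeftSymmetry.

(** * Commutators with generators classify *)

Section Generators.
Variables (G : finGroupType) (I : finType) (x : I -> G).
Hypothesis x_gen : <<[set x i | i : I]>>%g = [set: G].

Lemma generators_ind (P : G -> Prop) :
  P 1%g -> (forall i c, P c -> P (x i * c)%g) -> forall c, P c.
Proof.
move=> P1 PM c; have: c \in <<[set x i | i : I]>>%g by rewrite x_gen inE.
case/gen_prodgP=> n [d d_in ->].
by elim/big_rec: _ => // i y _; have /imsetP[j _ ->] := d_in i; apply: PM.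
Qed.

Section Eigenfunction.
Variables (K : numClosedFieldType) (b : I -> G -> K).
Hypothesis b_neq0 : forall i c, b i c != 0.
Hypothesis b_comm : forall i j c,
  b i c * b j (x i * c)%g = b j c * b i (x j * c)%g.
Hypothesis x_comm : forall i j, (x i * x j = x j * x i)%g.

(** The operators [phi |-> (fun c => b i c * phi (x i * c))] commute, hence have
    a common eigenvector. Its eigenvalues are nonzero as the operators are
    injective, so its zero set is stable under all translations and therefore
    empty. *)
Lemma common_eigenfunction :
  exists2 phi : G -> K, forall c, phi c != 0
    & exists t : I -> K, forall i c, b i c * phi (x i * c)%g = t i * phi c.
Proof.
(* Acting on row vectors, [M i] is the operator attached to [i]. *)
pose M i := \matrix_(p < #|G|, q < #|G|)
  (b i (enum_val q) *+ (enum_val p == x i * enum_val q)%g).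
have mulM (i : I) (F : 'I_#|G| -> K) q :
    \sum_p F p * M i p q
    = F (enum_rank (x i * enum_val q)%g) * b i (enum_val q).
  rewrite (bigD1 (enum_rank (x i * enum_val q)%g)) //= big1 => [|p].
    by rewrite addr0 mxE enum_rankK eqxx.
  by rewrite mxE -(inj_eq enum_val_inj) enum_rankK => /negPf->; rewrite mulr0.
have Mcomm i j : M i *m M j = M j *m M i.
  apply/matrixP=> p q; rewrite !mxE !mulM !mxE enum_rankK !mulgA x_comm.
  by rewrite !mulrnAl enum_rankK mulgA mulrC b_comm mulrC.
have [||v v0 /allP v_stable] := @common_eigenvector K #|G| [seq M i | i : I].
- by apply/card_gt0P; exists 1%g.
- by move=> _ _ /imageP[i _ ->] /imageP[j _ ->]; apply: Mcomm.
pose phi c := v 0 (enum_rank c).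
have /fin_all_exists[t eig] i :
    exists t, forall c, b i c * phi (x i * c)%g = t * phi c.
  have /v_stable/sub_rVP[t def_t] : M i \in [seq M i | i : I].
    exact: image_f.
  exists t => c; have /rowP/(_ (enum_rank c)) := def_t.
  by rewrite !mxE mulM enum_rankK mulrC.
have [d phi_d] : exists d, phi d != 0.
  apply/existsP/contraT; rewrite negb_exists => /forallP phi0.
  case/eqP: v0; apply/rowP=> p; rewrite mxE -[p]enum_valK.
  by apply/eqP; have:= phi0 (enum_val p); rewrite negbK.
have t0 i : t i != 0.
  apply: contraNneq phi_d => ti0.
  have /eqP := eig i ((x i)^-1 * d)%g.
  by rewrite ti0 mul0r mulKVg mulf_eq0 (negPf (b_neq0 _ _)).
have step i c : (phi (x i * c)%g == 0) = (phi c == 0).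
  have /(congr1 (eq_op^~ 0)) := eig i c.
  by rewrite !mulf_eq0 (negPf (b_neq0 _ _)) (negPf (t0 i)).
exists phi; last by exists t.
have trans g : forall c, (phi (g * c)%g == 0) = (phi c == 0).
  elim/generators_ind: g => [|i g IHg] c; first by rewrite mul1g.
  by rewrite -mulgA step IHg.
by move=> c; rewrite -(mulgKV d c) trans.
Qed.

End Eigenfunction.

Section Classification.
Variable K : numClosedFieldType.
Hypothesis mulgC : commutative (@mulg G).
Implicit Types C D B : G -> G -> K.

(** An eigenfunction [phi] as above for [b i = B (x i)] gives, suitably
    rescaled, the cochain: after division by its coboundary, [B (x i) _] is 1,
    so that the symmetry makes [B a _] invariant under the generators, hence
    equal to its value at the identity. *)
Lemma symmetric_coboundary B :
    (forall a b, B a b != 0) -> left_symmetric B ->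
    (forall a, B a 1%g = B 1%g 1%g) ->
    (forall g i, B g (x i) = B (x i) g) ->
  exists2 f : G -> K, forall g, f g != 0
    & forall a b, B a b = f a * f b / f (a * b)%g.
Proof.
move=> B0 sB B1 Bx.
have comm a i c : B (x i) c * B a (x i * c)%g = B a c * B (x i) (a * c)%g.
  by apply: (mulIf (B0 (x i) a)); rewrite sB Bx.
have [phi phi0 [t eig]] :
    exists2 phi : G -> K, forall c, phi c != 0
      & exists t : I -> K,
          forall i c, B (x i) c * phi (x i * c)%g = t i * phi c.
  by apply: common_eigenfunction => // i j c; rewrite comm.
(* Rescaled so that the relation at the identity gives [t i = f (x i)]. *)
pose f c := B 1%g 1%g / phi 1%g * phi c.
have f0 c : f c != 0 by rewrite /f !mulf_eq0 invr_eq0 !negb_or B0 !phi0.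
have f1 : f 1%g = B 1%g 1%g by rewrite /f mulfVK.
have fx i : f (x i) = t i.
  apply: (mulfI (B0 (x i) 1%g)); have := eig i 1%g; rewrite mulg1 => eig1.
  by rewrite /f mulrCA eig1 B1 mulrCA mulfVK // mulrC.
have Bfx i c : B (x i) c = f (x i) * f c / f (x i * c)%g.
  apply: (mulIf (f0 (x i * c)%g)); rewrite mulfVK // fx.
  by rewrite /f mulrCA eig mulrCA.
exists f => // a b.
suff: B a b * f (a * b)%g / (f a * f b) = B a 1%g * f a / (f a * f 1%g).
  rewrite B1 f1 [f a * B _ _]mulrC divff; last exact: mulf_neq0.
  by move=> /divr1_eq <-; rewrite mulfK.
elim/generators_ind: b => [|i b IHb]; first by rewrite mulg1.
rewrite -{}IHb; have := comm a i b; rewrite !Bfx.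
have -> : (a * (x i * b) = x i * (a * b))%g by rewrite !mulgA [(a * x i)%g]mulgC.
move=> E.
have -> : B a (x i * b)%g = B a b * (f (x i) * f (a * b)%g / f (x i * (a * b))%g)
    / (f (x i) * f b / f (x i * b)%g).
  by rewrite -E; field; rewrite !f0.
by field; rewrite !f0.
Qed.

Lemma commutator_classifies C D :
    (forall a b, C a b != 0) -> (forall a b, D a b != 0) ->
    left_symmetric C -> left_symmetric D ->
    (forall a, C a 1%g = C 1%g 1%g) -> (forall a, D a 1%g = D 1%g 1%g) ->
    (forall g i, C g (x i) / C (x i) g = D g (x i) / D (x i) g) ->
  exists2 f : G -> K, forall g, f g != 0
    & forall a b, D a b = f a * f b * C a b / f (a * b)%g.
Proof.
move=> C0 D0 sC sD C1 D1 eq_CD; pose B a b := D a b / C a b.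
have [||a|g i|f f0 def_B] := @symmetric_coboundary B.
- by move=> a b; rewrite mulf_neq0 ?invr_neq0.
- exact: left_symmetricM sD (left_symmetricV sC).
- by rewrite /B C1 D1.
- have := eq_CD g i; rewrite /B => E; apply/eqP; rewrite eqr_div //.
  move/eqP: E; rewrite eqr_div // => /eqP E; apply/eqP.
  by rewrite mulrC [RHS]mulrC E mulrC.
exists f => // a b; rewrite mulrAC -def_B mulfVK //.
Qed.

End Classification.
End Generators.

(** * Constraints on the commutators *)

Section CommutatorFactor.
Variables (K : fieldType) (G : finGroupType) (C : G -> G -> K).
Hypothesis mulgC : commutative (@mulg G).
Hypothesis C_neq0 : forall a b, C a b != 0.
Hypothesis C_sym : left_symmetric C.

Definition commutator_factor (D : G -> G -> K) (g h : G) := D g h / D h g.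
Local Notation y := (commutator_factor C).

Lemma commutator_factor_neq0 g h : y g h != 0.
Proof. by rewrite mulf_neq0 ?invr_neq0. Qed.

Variables (h : G) (m : nat).
Hypothesis hm : (h ^+ m = 1)%g.

(** The scalar by which [L_h ^ m] acts in degree [d], for [h] of order dividing
    [m]: moving [L_g] past the [m] factors costs [y g h ^+ m], while the
    scalars of [L_g] run over a full [h]-orbit on both sides and cancel. *)
Lemma commutator_factor_norm g d :
  \prod_(s < m) C h (h ^+ s * d)%g
  = y g h ^+ m * \prod_(s < m) C h (h ^+ s * (g * d))%g.
Proof.
have cycle : \prod_(s < m) C g (h ^+ s.+1 * d)%g = \prod_(s < m) C g (h ^+ s * d)%g.
  case: m hm => [|m'] hm'; first by rewrite !big_ord0.
  rewrite big_ord_recr [RHS]big_ord_recl /= mulrC hm' expg0.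
  by congr (_ * _); apply: eq_bigr.
apply: (@mulfI _ (\prod_(s < m) C g (h ^+ s * d)%g)).
  by apply/prodf_neq0.
rewrite -{1}cycle -[m in y g h ^+ m]card_ord -prodr_const -!big_split /=.
apply: eq_bigr => s _; set c := (h ^+ s * d)%g.
have -> : (h ^+ s.+1 * d = h * c)%g by rewrite mulgA -expgS.
have -> : (h ^+ s * (g * d) = g * c)%g.
  by rewrite !mulgA [(_ * g)%g]mulgC.
apply: (mulIf (C_neq0 h g)).
transitivity (C h c * C g (h * c)%g * C h g); first by ring.
by rewrite C_sym /commutator_factor; field.
Qed.

(** The norm at [d] is [y g h ^+ m] times the norm at [g * d]; moving from 1 to
    [g1 * g2] in one step or in two gives the claim. *)
Lemma commutator_factor_hom g1 g2 :
  y (g1 * g2)%g h ^+ m = y g1 h ^+ m * y g2 h ^+ m.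
Proof.
have N0 d : \prod_(s < m) C h (h ^+ s * d)%g != 0 by apply/prodf_neq0.
apply: (mulIf (N0 (g1 * g2)%g)).
have := commutator_factor_norm (g1 * g2)%g 1%g; rewrite mulg1 => <-.
rewrite (commutator_factor_norm g2 1%g) mulg1 (commutator_factor_norm g1 g2).
by rewrite mulrCA mulrA.
Qed.

Lemma commutator_factor_1 : y 1%g h ^+ m = 1.
Proof.
apply: (mulfI (expf_neq0 m (commutator_factor_neq0 1%g h))).
by rewrite -commutator_factor_hom mulg1 mulr1.
Qed.

Lemma commutator_factorX g e : y (g ^+ e)%g h ^+ m = y g h ^+ m ^+ e.
Proof.
elim: e => [|e IHe]; first by rewrite expg0 commutator_factor_1 expr0.
by rewrite expgS exprS commutator_factor_hom IHe.
Qed.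

Lemma commutator_factor_prod (I : Type) (r : seq I) (F : I -> G) :
  y (\prod_(i <- r) F i)%g h ^+ m = \prod_(i <- r) y (F i) h ^+ m.
Proof.
elim: r => [|i r IHr]; first by rewrite !big_nil commutator_factor_1.
by rewrite !big_cons commutator_factor_hom IHr.
Qed.

Lemma commutator_factor_order g e : (g ^+ e = 1)%g -> y g h ^+ (e * m) = 1.
Proof.
by move=> ge; rewrite mulnC exprM -commutator_factorX ge commutator_factor_1.
Qed.

End CommutatorFactor.

Section CommutatorFactorInvariance.
Variables (K : fieldType) (G : finGroupType).
Hypothesis mulgC : commutative (@mulg G).

(** The factors [f g * f h / f (g * h)] of a change of basis are symmetric in
    [g] and [h], and disappear in the quotient. *)
Lemma iso_commutator_factor (W V : twisted_algebra K G) w v C D :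
    graded_isomorphic W V ->
    @graded_basis K G W w -> structure_constant w C ->
    @graded_basis K G V v -> structure_constant v D ->
  forall g h, commutator_factor C g h = commutator_factor D g h.
Proof.
move=> iso wB Cw vB Dv g h.
have [v' vB' Cv'] := iso_structure_constant iso wB Cw.
have [f f0 def_D] := change_basis vB' Cv' vB Dv.
have C0 := structure_constant_neq0 wB Cw; have D0 := structure_constant_neq0 vB Dv.
have E a b : D a b = f a * f b * C a b / f (a * b)%g by rewrite -def_D mulfK.
rewrite /commutator_factor !E [(h * g)%g]mulgC; field.
by rewrite !f0 !C0.
Qed.

End CommutatorFactorInvariance.

(** * Coordinates in a product of cyclic groups *)

Section CyclicProduct.
Variables (k : nat) (n : 'I_k -> nat).
Hypothesis n_gt0 : forall i, (0 < n i)%N.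

Definition cyclic_coord (a : Zprod n) (i : 'I_k) : nat :=
  ((a : {dffun forall i : 'I_k, cyclic_factor (n i)}) i : 'I_(n i).-1.+1).
Local Notation "a `# i" := (cyclic_coord a i)
  (at level 2, i at level 1, format "a `# i").

Lemma cyclic_coord_lt a i : (a`#i < n i)%N.
Proof. by rewrite -[ltnRHS](prednK (n_gt0 i)) ltn_ord. Qed.

Lemma cyclic_coord_inj a b : (forall i, a`#i = b`#i) -> a = b.
Proof. by move=> eq_ab; apply/ffunP=> i; apply/ord_inj/eq_ab. Qed.

Lemma cyclic_coord1 i : (1%g)`#i = 0%N.
Proof. by rewrite /cyclic_coord ffunE. Qed.

Lemma cyclic_coordM a b i : (a * b)%g`#i = ((a`#i + b`#i) %% n i)%N.
Proof. by rewrite /cyclic_coord ffunE; apply: congr1 (prednK (n_gt0 i)). Qed.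

Lemma cyclic_coordX a e i : (a ^+ e)%g`#i = ((a`#i * e) %% n i)%N.
Proof.
elim: e => [|e IHe]; first by rewrite expg0 cyclic_coord1 muln0 mod0n.
by rewrite expgS cyclic_coordM IHe modnDmr mulnS.
Qed.

Lemma Zprod_mulgC : commutative (@mulg (Zprod n)).
Proof. by move=> a b; apply: cyclic_coord_inj => i; rewrite !cyclic_coordM addnC. Qed.

Definition cyclic_gen (i : 'I_k) : Zprod n :=
  @dfung1 _ (fun i => cyclic_factor (n i)) i (inZp 1 : 'I_(n i).-1.+1).

Lemma cyclic_coord_gen i j : (cyclic_gen i)`#j = ((i == j) %% n j)%N.
Proof.
rewrite /cyclic_coord /cyclic_gen; case: eqVneq => [<-|ij].
  by rewrite dfung1_id; apply: congr1 (prednK (n_gt0 i)).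
by rewrite dfung1_dflt // mod0n.
Qed.

Lemma cyclic_gen_order i : (cyclic_gen i ^+ n i = 1)%g.
Proof.
apply: cyclic_coord_inj => j; rewrite cyclic_coordX cyclic_coord1 cyclic_coord_gen.
by case: eqP => [<-|_]; rewrite ?modnMl ?modnMr ?mod0n ?mul0n ?mod0n.
Qed.

Lemma cyclic_gen1 i : n i = 1%N -> cyclic_gen i = 1%g.
Proof. by move=> ni1; rewrite -[LHS]expg1 -ni1 cyclic_gen_order. Qed.

Lemma cyclic_gen_prod a : a = (\prod_i cyclic_gen i ^+ a`#i)%g.
Proof.
apply: cyclic_coord_inj => j.
have coord_prod (r : seq 'I_k) (F : 'I_k -> Zprod n) :
    (\prod_(i <- r) F i)%g`#j = ((\sum_(i <- r) (F i)`#j) %% n j)%N.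
  elim: r => [|i r IHr]; first by rewrite !big_nil cyclic_coord1 mod0n.
  by rewrite !big_cons cyclic_coordM IHr modnDmr.
rewrite coord_prod (bigD1 j) //= big1 => [|i /negPf ij].
  rewrite addn0 cyclic_coordX cyclic_coord_gen eqxx modnMml mul1n modn_mod.
  by rewrite modn_small ?cyclic_coord_lt.
by rewrite cyclic_coordX cyclic_coord_gen ij mod0n mul0n mod0n.
Qed.

Lemma cyclic_gen_generates : <<[set cyclic_gen i | i : 'I_k]>>%g = [set: Zprod n].
Proof.
apply/setP=> a; rewrite inE [a]cyclic_gen_prod group_prod // => i _.
by rewrite groupX // mem_gen // imset_f.
Qed.

(** * Model structure constants *)

Lemma root_neq0 (F : fieldType) (z : F) m : (0 < m)%N -> z ^+ m = 1 -> z != 0.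
Proof.
move=> m0 zm; apply: contraTneq isT => z0.
by have := oner_neq0 F; rewrite -zm z0 expr0n gtn_eqF ?eqxx.
Qed.

Section ModelConstant.
Variables (K : fieldType) (lam : Zprod n -> 'I_k -> K) (q : 'I_k -> 'I_k -> K).
Hypothesis lam_root : forall g i, lam g i ^+ n i = 1.
Hypothesis q_root : forall i j, q i j ^+ (n i * n j)%N = 1.

(** The multiple of [n j] lost when reducing the sum of the coordinates. *)
Definition wrap (j : 'I_k) (a c : Zprod n) : int :=
  (a`#j)%:Z + (c`#j)%:Z - ((a * c)%g`#j)%:Z.

(** The first term is a bilinear form on integer vectors, whose commutator is
    [q i j]. The second corrects for reducing coordinates modulo [n j]: it is
    what moving the [n j]-th power of the [j]-th generator past the [i]-th
    generators costs. *)
Definition twist_exponent (i j : 'I_k) (a c : Zprod n) : int :=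
  (a`#i)%:Z * (c`#j)%:Z - wrap j a c * ((a`#i)%:Z + (c`#i)%:Z).

(** Left multiplication by [w_a] is the character [lam a] times a product of
    powers of generators whose commutators are given by [q]. *)
Definition model_constant (a c : Zprod n) : K :=
  (\prod_i lam a i ^+ c`#i) * \prod_i \prod_j q i j ^ twist_exponent i j a c.

Lemma lam_neq0 g i : lam g i != 0.
Proof. exact: root_neq0 (n_gt0 i) (lam_root g i). Qed.

Lemma q_neq0 i j : q i j != 0.
Proof. by apply: root_neq0 (q_root i j); rewrite muln_gt0 !n_gt0. Qed.

Lemma model_constant_neq0 a c : model_constant a c != 0.
Proof.
rewrite mulf_neq0 //; first by apply/prodf_neq0 => i _; rewrite expf_neq0 ?lam_neq0.
by do 2!apply/prodf_neq0 => ? _; rewrite expfz_neq0 ?q_neq0.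
Qed.

Lemma wrapP j a c :
  exists t : int, (a`#j)%:Z + (c`#j)%:Z = ((a * c)%g`#j)%:Z + (n j)%:Z * t.
Proof.
exists ((a`#j + c`#j) %/ n j)%N.
by rewrite -PoszD {1}(divn_eq (a`#j + c`#j) (n j)) -cyclic_coordM PoszD addrC mulnC.
Qed.

Lemma exprz_period (z : K) (m : nat) (e1 e2 u : int) :
  (0 < m)%N -> z ^+ m = 1 -> e1 = e2 + m%:Z * u -> z ^ e1 = z ^ e2.
Proof.
move=> m0 zm ->; have z0 := root_neq0 m0 zm.
by rewrite expfzDr // -exprz_exp -exprnP zm exp1rz mulr1.
Qed.

(** Modulo [n i * n j], every wrap in direction [j] multiplies a coordinate sum
    that matters only modulo [n i]. The exponents of the two sides then differ
    by products of a wrap in direction [i] with one in direction [j]. *)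
Lemma pair_left_symmetric i j :
  left_symmetric (fun a c => q i j ^ twist_exponent i j a c).
Proof.
move=> a b c; rewrite -!expfzDr ?q_neq0 //.
have [[s Es] [s' Es']] := (wrapP i b c, wrapP i a c).
have [[t Et] [t' Et']] := (wrapP j a (b * c)%g, wrapP j b (a * c)%g).
apply: (@exprz_period _ (n i * n j)%N _ _ (s * t - s' * t')) => //.
  by rewrite muln_gt0 !n_gt0.
rewrite /twist_exponent /wrap PoszM [(b * a)%g]Zprod_mulgC.
have Eabc : (b * (a * c) = a * (b * c))%g by rewrite !mulgA [(b * a)%g]Zprod_mulgC.
rewrite Eabc in Et' *.
have -> : ((b * c)%g`#i)%:Z = (b`#i)%:Z + (c`#i)%:Z - (n i)%:Z * s by rewrite Es addrK.
have -> : ((a * c)%g`#i)%:Z = (a`#i)%:Z + (c`#i)%:Z - (n i)%:Z * s' by rewrite Es' addrK.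
have -> : ((a * c)%g`#j)%:Z
    = (a`#j)%:Z + ((b * c)%g`#j)%:Z - (n j)%:Z * t + (n j)%:Z * t' - (b`#j)%:Z.
  by rewrite Et addrK -Et' addrC addKr.
have -> : ((a * (b * c))%g`#j)%:Z = (a`#j)%:Z + ((b * c)%g`#j)%:Z - (n j)%:Z * t.
  by rewrite Et addrK.
ring.
Qed.

Lemma left_symmetric_prod (I : Type) (r : seq I)
    (F : I -> Zprod n -> Zprod n -> K) :
  (forall i, left_symmetric (F i)) ->
  left_symmetric (fun a c => \prod_(i <- r) F i a c).
Proof.
move=> sF a b c; rewrite -!big_split /=.
by apply: eq_bigr => i _; apply: sF.
Qed.

Lemma model_constant_left_symmetric : left_symmetric model_constant.
Proof.
apply: (@left_symmetricM _ _ (fun a c => \prod_i lam a i ^+ c`#i)).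
  apply: left_symmetric_prod => i a b c.
  have lamM g u v : lam g i ^+ (u * v)%g`#i = lam g i ^+ u`#i * lam g i ^+ v`#i.
    by rewrite cyclic_coordM expr_mod // exprD.
  by rewrite !lamM; ring.
by do 2!apply: left_symmetric_prod => ?; apply: pair_left_symmetric.
Qed.

Lemma twist_exponent1g i j c : twist_exponent i j 1%g c = 0.
Proof. by rewrite /twist_exponent /wrap mul1g !cyclic_coord1 !add0r subrr !mul0r. Qed.

Lemma twist_exponentg1 i j a : twist_exponent i j a 1%g = 0.
Proof.
by rewrite /twist_exponent /wrap mulg1 !cyclic_coord1 !addr0 subrr mulr0 mul0r.
Qed.

Lemma model_constantg1 a : model_constant a 1%g = 1.
Proof.
rewrite /model_constant big1 => [|i _]; last by rewrite cyclic_coord1.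
rewrite mul1r big1 // => i _; rewrite big1 // => j _.
by rewrite twist_exponentg1 expr0z.
Qed.

Hypothesis lam1 : forall i, lam 1%g i = 1.

Lemma model_constant1g c : model_constant 1%g c = 1.
Proof.
rewrite /model_constant big1 => [|i _]; last by rewrite lam1 expr1n.
rewrite mul1r big1 // => i _; rewrite big1 // => j _.
by rewrite twist_exponent1g expr0z.
Qed.

Hypothesis lam_gen : forall i j, lam (cyclic_gen i) j = 1.
Hypothesis q1l : forall i j, n i = 1%N -> q i j = 1.
Hypothesis q1r : forall i j, n j = 1%N -> q i j = 1.

(** The corrections by wraps are symmetric and cancel in the commutator, which
    leaves the commutator of the bilinear part. *)
Lemma model_commutator_factor g l :
  commutator_factor model_constant g (cyclic_gen l)
  = lam g l * \prod_i (q i l / q l i) ^+ g`#i.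
Proof.
have [nl1|nl_neq1] := eqVneq (n l) 1%N.
  rewrite cyclic_gen1 // /commutator_factor model_constantg1 model_constant1g.
  rewrite divr1 big1 => [|i _]; last by rewrite q1r // q1l // divr1 expr1n.
  by have := lam_root g l; rewrite nl1 expr1 => ->; rewrite mulr1.
have coord_l j : (cyclic_gen l)`#j = (l == j).
  rewrite cyclic_coord_gen; case: eqP => [<-|_]; last by rewrite mod0n.
  by rewrite modn_small // ltn_neqAle eq_sym nl_neq1 n_gt0.
rewrite /commutator_factor /model_constant.
rewrite [\prod_i lam (cyclic_gen l) i ^+ _]big1 => [|i _]; last first.
  by rewrite lam_gen expr1n.
rewrite mul1r -mulrA; congr (_ * _).
  rewrite (bigD1 l) //= coord_l eqxx expr1 big1 ?mulr1 // => i /negPf.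
  by rewrite coord_l eq_sym => ->.
(* Only the bilinear parts of the two exponents differ. *)
have expE i j : twist_exponent i j g (cyclic_gen l)
    = twist_exponent i j (cyclic_gen l) g
      + ((g`#i)%:Z * (l == j)%:Z - (l == i)%:Z * (g`#j)%:Z).
  rewrite /twist_exponent /wrap [(cyclic_gen l * g)%g]Zprod_mulgC !coord_l.
  by ring.
rewrite -prodfV -big_split /=.
under eq_bigr => i _.
  rewrite -prodfV -big_split /=.
  under eq_bigr => j _.
    rewrite expE expfzDr ?q_neq0 // [X in X / _]mulrC mulfK ?expfz_neq0 ?q_neq0 //.
    rewrite expfzDr ?q_neq0 //.
    over.
  rewrite big_split /=.
  over.
rewrite big_split /= [X in _ * X]exchange_big -big_split /=.
apply: eq_bigr => i _; rewrite expr_div_n.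
congr (_ * _); rewrite (bigD1 l) //= big1 => [|j /negPf lj].
- by rewrite eqxx !mulr1.
- by rewrite eq_sym lj mulr0.
- by rewrite eqxx mul1r mulr1 exprnN.
- by rewrite eq_sym lj mul0r oppr0.
Qed.

End ModelConstant.
End CyclicProduct.

(** * Structure constants with values in a subgroup *)

Section SubgroupOfUnits.
Variables (K : fieldType) (A : {pred K}).
Hypothesis A_subgroup : GRing.divr_closed A.

Lemma subgroup1 : 1 \in A. Proof. by case: A_subgroup. Qed.

Lemma subgroup_div z1 z2 : z1 \in A -> z2 \in A -> z1 / z2 \in A.
Proof. by case: A_subgroup => _; apply. Qed.

Lemma subgroupV z : z \in A -> z^-1 \in A.
Proof. by move=> Az; rewrite -div1r subgroup_div ?subgroup1. Qed.

Lemma subgroupM z1 z2 : z1 \in A -> z2 \in A -> z1 * z2 \in A.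
Proof. by move=> Az1 Az2; rewrite -[z2]invrK subgroup_div ?subgroupV. Qed.

Lemma subgroupX z m : z \in A -> z ^+ m \in A.
Proof.
by move=> Az; elim: m => [|m IHm]; rewrite ?subgroup1 // exprS subgroupM.
Qed.

Lemma subgroupXz z (e : int) : z \in A -> z ^ e \in A.
Proof. by move=> Az; case: e => m; rewrite ?subgroupV ?subgroupX. Qed.

Lemma subgroup_prod (I : Type) (r : seq I) (F : I -> K) :
  (forall i, F i \in A) -> \prod_(i <- r) F i \in A.
Proof.
by move=> AF; elim/big_ind: _ => //; [apply: subgroup1 | apply: subgroupM].
Qed.

Lemma model_constant_in k (n : 'I_k -> nat) lam q :
    (forall g i, lam g i \in A) -> (forall i j, q i j \in A) ->
  forall a c : Zprod n, model_constant lam q a c \in A.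
Proof.
move=> Alam Aq a c; apply: subgroupM.
  by apply: subgroup_prod => i; apply: subgroupX.
by do 2!apply: subgroup_prod => ?; apply: subgroupXz.
Qed.

End SubgroupOfUnits.

(** * Counting roots of unity *)

Section Counting.

Lemma card_roots_in (K : fieldType) (A : {fset K}) m :
  #|[pred z : A | val z ^+ m == 1]| = #|` roots_in A m|.
Proof.
rewrite -(size_image val); apply/perm_size/uniq_perm.
- by rewrite map_inj_uniq ?enum_uniq //; apply: val_inj.
- exact: fset_uniq.
move=> z; rewrite !inE /=; apply/imageP/andP => [[u] | [Az zm]].
  by rewrite inE => um ->; rewrite (valP u).
by exists [` Az]%fset.
Qed.

Lemma card_family_prod (T U : finType) (F : T -> pred U) :
  #|family F| = (\prod_t #|F t|)%N.
Proof. by rewrite card_family foldrE big_map enumT. Qed.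

Lemma prod_offdiagonal (F : comRingType) k (g : 'I_k -> 'I_k -> F) :
    (forall i, g i i = 1) ->
  \prod_i \prod_j g i j = \prod_(i < k) \prod_(j < k | (i < j)%N) (g i j * g j i).
Proof.
move=> gii; under [RHS]eq_bigr do rewrite big_split.
rewrite big_split /= [X in _ = _ * X](exchange_big_dep xpredT) //= -big_split.
apply: eq_bigr => i _; rewrite (bigID (fun j : 'I_k => (i < j)%N)) /=; congr (_ * _).
rewrite (bigID (fun j : 'I_k => (j < i)%N)) /=.
rewrite [X in _ * X]big1 ?mulr1 => [|j].
  by apply: eq_bigl => j; case: ltngtP.
by case: (ltngtP i j) => // /ord_inj->.
Qed.

(** For [i < j] the term of the left-hand side splits off [rho (n j)] if
    [n i = 1] and [rho (n i)] if [n j = 1]; collected over all pairs these make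
    up one copy of [\prod_j rho (n j)] for each trivial factor. *)
Lemma prod_pairs_trivial (F : fieldType) k (n : 'I_k -> nat) (rho : nat -> F) :
    rho 1%N = 1 ->
  \prod_(i < k) \prod_(j < k | (i < j)%N) rho (n i * n j)%N
  = (\prod_j rho (n j)) ^+ #|[pred i | n i == 1%N]|
    * \prod_(i < k) \prod_(j < k)
        rho (if [&& (i < j)%N, n i != 1%N & n j != 1%N] then n i * n j else 1)%N.
Proof.
move=> rho1; rewrite -prodr_const [X in _ = X * _]big_mkcond /=.
(* The share of the trivial factor [i] in the pair formed by [i] and [j]. *)
pose g (i j : 'I_k) : F := if n i == 1%N then rho (n j) else 1.
transitivity (\prod_i \prod_j g i j * \prod_(i < k) \prod_(j < k)
    rho (if [&& (i < j)%N, n i != 1%N & n j != 1%N] then n i * n j else 1)%N);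
  last first.
  congr (_ * _); apply: eq_bigr => i _; rewrite inE /g.
  by case: eqP => // _; rewrite big1.
rewrite prod_offdiagonal /g => [|i]; last by case: eqP => // ->.
rewrite -big_split; apply: eq_bigr => i _ /=.
rewrite [X in _ = _ * X](bigID (fun j : 'I_k => (i < j)%N)) /=.
rewrite [X in _ = _ * (_ * X)]big1 => [|j /negPf-> //].
rewrite mulr1 -big_split; apply: eq_bigr => j -> /=.
case: eqP => [->|_]; case: eqP => [->|_] /=;
  by rewrite ?mul1n ?muln1 ?rho1 ?mulr1 ?mul1r.
Qed.

End Counting.

(** * Parameters of the algebras and their number *)

Section AdmissibleParameters.
Variables (K : numClosedFieldType) (k : nat) (n : 'I_k -> nat).
Hypothesis n_gt0 : forall i, (0 < n i)%N.
Variable A : {fset K}.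
Hypothesis A_subgroup : GRing.divr_closed (mem A).
Local Notation G := (Zprod n).

(** The elements at which [lam] is normalised: the corresponding left
    multiplications are scalars and the chosen generators. *)
Definition based : {set G} := 1%g |: [set cyclic_gen n i | i : 'I_k].

(** Exponent 1 forces the value 1, so that each parameter ranges over the
    roots of unity of a given exponent; for [q_exponent], this makes [q i j]
    trivial unless [i < j] and both factors are nontrivial. *)
Definition lam_exponent (t : G * 'I_k) : nat := if t.1 \in based then 1 else n t.2.

Definition q_exponent (t : 'I_k * 'I_k) : nat :=
  if [&& (t.1 < t.2)%N, n t.1 != 1%N & n t.2 != 1%N] then (n t.1 * n t.2)%N else 1.

Definition roots_family (T : finType) (e : T -> nat) :=
  family (fun t => [pred z : A | val z ^+ e t == 1]).

Definition parameter : finType :=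
  ({ffun G * 'I_k -> A} * {ffun 'I_k * 'I_k -> A})%type.

Definition admissible : pred parameter :=
  [predX roots_family lam_exponent & roots_family q_exponent].

Definition lam_of (p : parameter) g i : K := val (p.1 (g, i)).
Definition q_of (p : parameter) i j : K := val (p.2 (i, j)).
Definition constant_of (p : parameter) : G -> G -> K :=
  model_constant (lam_of p) (q_of p).

Lemma roots_familyP (T : finType) (e : T -> nat) (F : {ffun T -> A}) :
  reflect (forall t, val (F t) ^+ e t = 1) (F \in roots_family e).
Proof.
by apply: (iffP familyP) => H t; have := H t; rewrite inE => /eqP.
Qed.

Lemma based1 : 1%g \in based. Proof. by rewrite !inE eqxx. Qed.
Lemma based_gen i : cyclic_gen n i \in based.
Proof. by rewrite !inE imset_f ?orbT. Qed.

Section Admissible.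
Variable p : parameter.
Hypothesis p_adm : p \in admissible.

Lemma lam_based g i : g \in based -> lam_of p g i = 1.
Proof.
move=> gS; case/andP: p_adm => /roots_familyP/(_ (g, i)) + _.
by rewrite /lam_exponent gS expr1.
Qed.

Lemma lam_root g i : lam_of p g i ^+ n i = 1.
Proof.
have [gS|gS] := boolP (g \in based); first by rewrite lam_based ?expr1n.
case/andP: p_adm => /roots_familyP/(_ (g, i)) + _.
by rewrite /lam_exponent (negPf gS).
Qed.

Lemma q_trivial (i j : 'I_k) :
  ~~ [&& (i < j)%N, n i != 1%N & n j != 1%N] -> q_of p i j = 1.
Proof.
move=> nij; case/andP: p_adm => _ /roots_familyP/(_ (i, j)).
by rewrite /q_exponent (negPf nij) expr1.
Qed.

Lemma q_root i j : q_of p i j ^+ (n i * n j)%N = 1.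
Proof.
have [ij|/q_trivial->] := boolP [&& (i < j)%N, n i != 1%N & n j != 1%N].
  case/andP: p_adm => _ /roots_familyP/(_ (i, j)).
  by rewrite /q_exponent ij.
by rewrite expr1n.
Qed.

Lemma constant_commutator g l :
  commutator_factor (constant_of p) g (cyclic_gen n l)
  = lam_of p g l * \prod_i (q_of p i l / q_of p l i) ^+ cyclic_coord g i.
Proof.
apply: model_commutator_factor => //.
- exact: lam_root.
- exact: q_root.
- by move=> i; rewrite lam_based ?based1.
- by move=> i j; rewrite lam_based ?based_gen.
- by move=> i j ni1; apply: q_trivial; rewrite ni1 eqxx andbF.
- by move=> i j nj1; apply: q_trivial; rewrite nj1 eqxx !andbF.
Qed.

Lemma constant_neq0 a c : constant_of p a c != 0.
Proof. exact: model_constant_neq0 lam_root q_root a c. Qed.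

Lemma constant_left_symmetric : left_symmetric (constant_of p).
Proof. exact: model_constant_left_symmetric lam_root q_root. Qed.

Lemma constant1g c : constant_of p 1%g c = 1.
Proof. by apply: model_constant1g => i; rewrite lam_based ?based1. Qed.

Lemma constantg1 a : constant_of p a 1%g = 1.
Proof. exact: model_constantg1. Qed.

Lemma constant_in a c : constant_of p a c \in A.
Proof.
apply: (@model_constant_in _ (mem A)) => // [g i|i j]; apply: valP.
Qed.

Lemma model_exists : exists W : twisted_algebra K G,
  exists2 w : G -> W, graded_basis w & structure_constant w (constant_of p).
Proof.
exists (model_algebra constant_neq0 constant1g constantg1).
exists (@model_basis K G); first exact: model_graded_basis.
exact: model_structure_constant.
Qed.

End Admissible.

Lemma cyclic_coord_gen_prod (F : 'I_k -> K) i :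
  (n i = 1%N -> F i = 1) ->
  \prod_j F j ^+ cyclic_coord (cyclic_gen n i) j = F i.
Proof.
move=> Fi1; rewrite (bigD1 i) //= big1 => [|j /negPf ji].
  rewrite cyclic_coord_gen // eqxx mulr1; case: (ltngtP (n i) 1%N) => ni.
  - by have := n_gt0 i; case: (n i) ni.
  - by rewrite modn_small.
  by rewrite Fi1 ?expr1n.
by rewrite cyclic_coord_gen // eq_sym ji mod0n expr0.
Qed.

(** The commutators of the generators are the [q i l], as [lam] is trivial
    there; the remaining commutators then determine [lam]. *)
Lemma constant_of_inj p p' : p \in admissible -> p' \in admissible ->
    (forall g l, commutator_factor (constant_of p) g (cyclic_gen n l)
               = commutator_factor (constant_of p') g (cyclic_gen n l)) ->
  p = p'.
Proof.
move=> adm adm' eq_pp'.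
have q_gen r : r \in admissible -> forall i l : 'I_k, (i < l)%N ->
    commutator_factor (constant_of r) (cyclic_gen n i) (cyclic_gen n l) = q_of r i l.
  move=> r_adm i l il; rewrite constant_commutator // lam_based ?based_gen //.
  rewrite mul1r cyclic_coord_gen_prod => [|ni1].
    by rewrite [q_of r l i]q_trivial ?divr1 // negb_and -leqNgt ltnW.
  by rewrite !q_trivial ?divr1 // ni1 eqxx !andbF.
have eq_q i j : q_of p i j = q_of p' i j.
  have [ij|ji] := ltnP i j; first by rewrite -!q_gen.
  by rewrite !q_trivial // negb_and -leqNgt ji.
have eq_lam g l : lam_of p g l = lam_of p' g l.
  have := eq_pp' g l; rewrite !constant_commutator //.
  under eq_bigr do rewrite !eq_q.
  apply: mulIf; apply/prodf_neq0 => i _.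
  by rewrite expf_neq0 // mulf_neq0 ?invr_neq0 // (q_neq0 n_gt0 (q_root adm')).
case: p p' => [lam q] [lam' q'] in adm adm' eq_pp' q_gen eq_q eq_lam *.
by congr (_, _); apply/ffunP=> -[s t]; apply: val_inj; [apply: eq_lam|apply: eq_q].
Qed.

(** The parameters are read off the commutators by the formula of
    [constant_commutator]; that they are roots of unity of the right exponents
    is the multiplicativity of [y _ h ^+ m]. *)
Lemma constant_of_surj (C : G -> G -> K) :
    (forall a b, C a b != 0) -> left_symmetric C ->
    (forall a b, C a b \in A) ->
    (forall a, C 1%g a = C 1%g 1%g) -> (forall a, C a 1%g = C 1%g 1%g) ->
  exists2 p, p \in admissible &
    forall g l, commutator_factor C g (cyclic_gen n l)
              = commutator_factor (constant_of p) g (cyclic_gen n l).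
Proof.
move=> C0 sC AC C1g Cg1; set y := commutator_factor C.
have Gc := @Zprod_mulgC k n n_gt0.
have Ay g h : y g h \in A by apply: (@subgroup_div _ (mem A)); rewrite ?AC.
have y0 g h : y g h != 0 by apply: commutator_factor_neq0.
have y1g g : y 1%g g = 1 by rewrite /y /commutator_factor C1g Cg1 divff.
have yg1 g : y g 1%g = 1 by rewrite /y /commutator_factor C1g Cg1 divff.
have yV g h : (y h g)^-1 = y g h by rewrite /y /commutator_factor invf_div.
pose Q i l := y (cyclic_gen n i) (cyclic_gen n l).
pose L g l := y g (cyclic_gen n l) / \prod_i Q i l ^+ cyclic_coord g i.
have AL g l : L g l \in A.
  apply: (@subgroup_div _ (mem A)) => //.
  by apply: (@subgroup_prod _ (mem A)) => // i; apply: (@subgroupX _ (mem A)) => //; apply: Ay.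
pose q0 (i j : 'I_k) := if (i < j)%N then Q i j else 1.
have Aq0 i j : q0 i j \in A.
  by rewrite /q0; case: ifP => _; [apply: Ay | apply: (@subgroup1 _ (mem A))].
pose p : parameter := ([ffun t => [` AL t.1 t.2]%fset],
                       [ffun t => [` Aq0 t.1 t.2]%fset]).
have lamE g l : lam_of p g l = L g l by rewrite /lam_of ffunE.
have qE i j : q_of p i j = q0 i j by rewrite /q_of ffunE.
have L_based g l : g \in based -> L g l = 1.
  rewrite !inE => /predU1P[->|/imsetP[i _ ->]].
    by rewrite /L y1g big1 ?divr1 // => i _; rewrite cyclic_coord1 expr0.
  rewrite /L cyclic_coord_gen_prod ?divff ?y0 // => ni1.
  by rewrite /Q cyclic_gen1 ?y1g.
have L_root g l : L g l ^+ n l = 1.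
  rewrite /L {1}[g](cyclic_gen_prod n_gt0) expr_div_n.
  rewrite (commutator_factor_prod Gc C0 sC (cyclic_gen_order n_gt0 l)).
  rewrite -prodrXl -prodf_div big1 // => i _.
  rewrite (commutator_factorX Gc C0 sC (cyclic_gen_order n_gt0 l)).
  by rewrite exprAC divff // !expf_neq0 ?y0.
have p_adm : p \in admissible.
  apply/andP; split; apply/roots_familyP => -[s t]; rewrite ffunE /=.
    rewrite /lam_exponent /=; case: ifP => gS; last exact: L_root.
    by rewrite L_based ?expr1n.
  rewrite /q_exponent /q0 /=; case: ltnP => st /=; last by rewrite expr1n.
  have [s1|s1] /= := eqVneq (n s) 1%N; first by rewrite /Q cyclic_gen1 ?y1g ?expr1n.
  have [t1|t1] /= := eqVneq (n t) 1%N.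
    by rewrite /Q [cyclic_gen n t]cyclic_gen1 ?yg1 ?expr1n.
  apply: (commutator_factor_order Gc C0 sC); exact: cyclic_gen_order.
exists p => // g l; rewrite constant_commutator // lamE /L -/y.
rewrite [X in _ * X](_ : _ = \prod_i Q i l ^+ cyclic_coord g i) ?mulfVK //.
  by apply/prodf_neq0 => i _; rewrite expf_neq0 ?y0.
apply: eq_bigr => i _; rewrite !qE /q0; congr (_ ^+ _).
case: ltngtP => [_|_|/ord_inj->]; rewrite ?divr1 ?div1r //; first exact: yV.
by rewrite /Q /y /commutator_factor divff.
Qed.

Theorem number_of_symmetric_algebras :
  number_of_classes
    (fun W : twisted_algebra K G =>
       symmetric12 W /\ structure_constants_in (mem A) W)
    (@graded_isomorphic K G) #|admissible|.
Proof.
have Gc := @Zprod_mulgC k n n_gt0.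
have adm (t : 'I_#|admissible|) : enum_val t \in admissible by apply: enum_valP.
have /fin_all_exists[f fP] (t : 'I_#|admissible|) := model_exists (adm t).
exists f; split=> [t|s t iso|W [symW [w [C [wB Cw AC]]]]].
- have [w wB Cw] := fP t; split.
    exact/(symmetric12P Gc wB Cw)/constant_left_symmetric.
  exists w, (constant_of (enum_val t)); split=> // a b.
  exact: constant_in.
- have [[v vB Cv] [w wB Cw]] := (fP s, fP t).
  apply/enum_val_inj/constant_of_inj => // g l.
  exact: (iso_commutator_factor Gc iso vB Cv wB Cw).
have C0 := structure_constant_neq0 wB Cw.
have [C1g Cg1] := structure_constant_1 wB Cw.
have sC : left_symmetric C by apply/(symmetric12P Gc wB Cw).
have [p p_adm eq_p] := constant_of_surj C0 sC AC C1g Cg1.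
have D1 a : constant_of p a 1%g = constant_of p 1%g 1%g by rewrite !constantg1.
have [h h0 def_p] := commutator_classifies (cyclic_gen_generates n_gt0) Gc
  C0 (constant_neq0 p_adm) sC (constant_left_symmetric p_adm) Cg1 D1 eq_p.
have [hB hC] := rescale_basis wB Cw h0.
exists (enum_rank_in p_adm p).
have [v vB] := fP (enum_rank_in p_adm p); rewrite enum_rankK_in // => Cv.
apply: structure_constant_iso hB _ vB Cv => a b.
by rewrite hC def_p.
Qed.

(** Trivial factors have generator 1 and do not contribute. *)
Lemma card_based : #|based| = #|[pred i | n i != 1%N]|.+1.
Proof.
have -> : based = 1%g |: [set cyclic_gen n i | i in [pred i | n i != 1%N]].
  apply/setP=> g; rewrite !inE; case: (g =P 1%g) => //= g1.
  apply/imsetP/imsetP => -[i ni def_g]; exists i => //.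
  by rewrite inE; apply: contra_notN g1 => /eqP ni1; rewrite def_g cyclic_gen1.
have gen_coord i : n i != 1%N -> cyclic_coord (cyclic_gen n i) i = 1%N.
  move=> ni; rewrite cyclic_coord_gen // eqxx modn_small //.
  by rewrite ltn_neqAle eq_sym ni n_gt0.
rewrite cardsU1 card_in_imset => [|i j ni nj eq_ij].
  rewrite (_ : 1%g \notin _) //; apply/imsetP=> -[i ni /(congr1 (fun g : G => cyclic_coord g i))].
  by rewrite cyclic_coord1 gen_coord.
apply/eqP; have := gen_coord i ni; rewrite eq_ij cyclic_coord_gen //.
by case: eqP => [->|_]; rewrite ?eqxx ?mod0n.
Qed.

Lemma card_admissible :
  #|admissible|%:R =
    (\prod_(i < k) (#|` roots_in A (n i)|%:R ^ (#|Zprod n|%:Z - (k + 1)%:Z)))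
    * (\prod_(i < k) \prod_(j < k | (i < j)%N)
         #|` roots_in A (n i * n j)%N|%:R) :> rat.
Proof.
pose rho m : rat := #|` roots_in A m|%:R.
have A1 : 1 \in A by apply: (@subgroup1 _ (mem A)).
have rho1 : rho 1%N = 1.
  rewrite /rho (_ : roots_in A 1 = [fset 1])%fset ?cardfs1 //.
  apply/fsetP=> z; rewrite !inE expr1 andbC.
  by case: eqP => [->|].
have rho0 m : rho m != 0.
  rewrite pnatr_eq0 cardfs_eq0; apply/fset0Pn; exists 1.
  by rewrite !inE expr1n eqxx A1.
rewrite /admissible cardX natrM !card_family_prod !natr_prod.
under eq_bigr do rewrite card_roots_in.
under [X in _ * X]eq_bigr do rewrite card_roots_in.
rewrite -(pair_bigA _ (fun g i => rho (lam_exponent (g, i)))).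
rewrite -(pair_bigA _ (fun i j => rho (q_exponent (i, j)))).
rewrite [X in _ = _ * X](prod_pairs_trivial n rho1) mulrA; congr (_ * _).
rewrite exchange_big /= -prodrXl -big_split /=; apply: eq_bigr => i _.
transitivity (rho (n i) ^+ #|~: based|).
  rewrite -prodr_const [RHS]big_mkcond; apply: eq_bigr => g _.
  by rewrite inE /lam_exponent /=; case: (g \in based).
rewrite -/(rho _) !exprnP -expfzDr //; congr (_ ^ _).
rewrite cardsCs setCK card_based -subzn -?card_based ?max_card // card_based.
have -> : (k + 1 = #|[pred i | n i == 1%N]| + #|[pred i | n i != 1%N]|.+1)%N.
  by rewrite [RHS]addnS addn1 -[k in LHS]card_ord -(cardC [pred i | n i == 1%N]).
by rewrite PoszD opprD -addrA [_ - _ + _]addrAC addNr add0r.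
Qed.

End AdmissibleParameters.

Theorem theorem20 (R : realType) (k : nat) (n : 'I_k -> nat)
    (n_gt0 : forall i, (0 < n i)%N)
    (A : {fset R[i]}) (A_nz : 0 \notin A)
    (A_subgroup : GRing.divr_closed (mem A)) :
  exists2 N : nat,
    number_of_classes
      (fun W : twisted_algebra R[i] (Zprod n) =>
         symmetric12 W /\ structure_constants_in (mem A) W)
      (@graded_isomorphic R[i] (Zprod n)) N
  & N%:R =
      (\prod_(i < k)
         (#|` roots_in A (n i)|%:R ^ (#|Zprod n|%:Z - (k + 1)%:Z)))
      * (\prod_(i < k) \prod_(j < k | (i < j)%N)
           #|` roots_in A (n i * n j)%N|%:R) :> rat.
Proof.
exists #|@admissible _ _ n A|; last exact: card_admissible.
exact: (@number_of_symmetric_algebras R[i] k n n_gt0 A).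
Qed.
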